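(* Let $n,p,k$ be integers with $1\le p<n$ and $0<k<n$, let $\bm Z$ be the random $n\times p$ covariate matrix described in the context, and let $\bm x\in\{0,1\}^n$ be the random assignment vector (independent of $\bm Z$) obtained by choosing $k$ of the $n$ coordinates uniformly at random and setting them to $1$ and all others to $0$. Then the rate of random assignment is $$\mathbb{E}\big[\bm x^{T}P_{\bm Z^\perp}\bm x\big]=\Theta\!\left((n-p)\frac{k(n-k)}{n^2}\right),$$ where the expectation is over $\bm x$, the statement holds for almost every $\bm Z$, and the implied constants are absolute. In particular, if $k/n=\rho$ is a constant in $(0,1)$, then this rate is $\Theta(n-p)$, with implied constants depending only on $\rho$.
   Context: Linear model: user $i\in\{1,\dots,n\}$ has consumption $y_i=\beta x_i+\bm\gamma^T\bm z_i+\epsilon_i$, where $x_i\in\{0,1\}$ is the treatment (demand response signal), $\bm z_i\in\mathbb{R}^p$ is a covariate vector and $\epsilon_i$ is white noise with variance $\sigma^2=1$. $\bm Z$ is the $n\times p$ matrix whose $i$-th row is $\bm z_i^T$; its last column is the all-ones vector (intercept) and its other $p-1$ columns have i.i.d. standard Gaussian entries, so $\bm Z$ has rank $p$ almost surely. Put $P_{\bm Z^\perp}=I-\bm Z(\bm Z^T\bm Z)^{-1}\bm Z^T$. The ordinary least squares estimator $\hat\beta$ of $\beta$ has variance $\sigma^2/(\bm x^TP_{\bm Z^\perp}\bm x)$; the ''rate'' of an assignment strategy is the growth rate of $\bm x^TP_{\bm Z^\perp}\bm x$, in expectation. $f=\Theta(g)$ means $c\,g\le f\le C\,g$ for constants $0<c\le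 C$. *)

(* Defs.v *)
From HB Require Import structures.
From mathcomp Require Import all_boot all_order all_algebra.
From mathcomp Require Import all_classical all_reals all_analysis.

Set Implicit Arguments.
Unset Strict Implicit.
Unset Printing Implicit Defensive.

Import Order.TTheory GRing.Theory Num.Theory.
Import numFieldNormedType.Exports.

Local Open Scope classical_set_scope.
Local Open Scope ring_scope.

Section Independence.
Context d (T : measurableType d) (R : realType) (P : probability T R).

Definition mutually_independent (I : finType) (D : {set I})
    (X : I -> {RV P >-> R}) : Prop :=
  forall (J : {set I}) (B : I -> set R),
    J \subset D -> (forall i, i \in J -> measurable (B i)) ->
    (P (\bigcap_(i in [set` J]) (X i @^-1` B i)) =
     \prod_(i in J) P (X i @^-1` B i))%E.

Definition sigma_generated (I : Type) (X : I -> {RV P >-> R}) : set (set T) :=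
  <<s \bigcup_i preimage_set_system setT (X i) measurable >>.

Definition independent_families (I J : Type)
    (X : I -> {RV P >-> R}) (Y : J -> {RV P >-> R}) : Prop :=
  forall A B : set T, sigma_generated X A -> sigma_generated Y B ->
    (P (A `&` B) = P A * P B)%E.

End Independence.

(* [invmx] is the identity on singular matrices, so this is the orthogonal
   projection only when Z has full column rank. *)
Definition proj_orth (R : realType) (n p : nat) (Z : 'M[R]_(n, p)) : 'M[R]_n :=
  1%:M - Z *m invmx (Z^T *m Z) *m Z^T.

Definition quad_form (R : realType) (n : nat) (A : 'M[R]_n) (x : 'cV[R]_n) : R :=
  (x^T *m A *m x) ord0 ord0.

Section Design.
Context d (T : measurableType d) (R : realType) (P : probability T R).
Variables n p : nat.

Definition covariate_mx (Z : 'I_n * 'I_p -> {RV P >-> R}) (w : T) : 'M[R]_(n, p) :=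
  \matrix_(i, j) Z (i, j) w.

Definition assignment_vec (x : 'I_n -> {RV P >-> R}) (w : T) : 'cV[R]_n :=
  \col_i x i w.

Definition covariate_entries : {set 'I_n * 'I_p} :=
  [set ij : 'I_n * 'I_p | (ij.2.+1 < p)%N]%SET.

Definition gaussian_covariates (Z : 'I_n * 'I_p -> {RV P >-> R}) : Prop :=
  [/\ forall i (j : 'I_p) w, j.+1 = p -> Z (i, j) w = 1,
      forall ij, ij \in covariate_entries ->
        forall B : set R, measurable B ->
          distribution P (Z ij) B = normal_prob 0 1 B &
      mutually_independent covariate_entries Z].

Definition random_assignment (k : nat) (x : 'I_n -> {RV P >-> R}) : Prop :=
  (forall i w, x i w = 0 \/ x i w = 1) /\
  forall A : {set 'I_n},
    P [set w | forall i, x i w = (i \in A)%:R] =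
      (if #|A| == k then ('C(n, k)%:R)^-1 else 0)%:E.

(* Only x is averaged, the matrix being held at a fixed value; when x is
   independent of the covariates this is the conditional expectation given
   the covariates. *)
Definition assignment_rate (x : 'I_n -> {RV P >-> R}) (Z : 'M[R]_(n, p)) : \bar R :=
  ('E_P[fun w => quad_form (proj_orth Z) (assignment_vec x w)])%E.

End Design.

(* Main.v *)
(* By exchangeability of the coordinates, E[x x^T] = a I + b 1 1^T with
   a = k (n - k) / (n (n - 1)).  When Z has full column rank, the projection Q
   off its column space has trace n - p, and Q 1 = 0 because of the intercept
   column; hence E[x^T Q x] = a (n - p) exactly, and n / (n - 1) lies in [1, 2].

   Z has full rank almost surely: we reverse the columns, so that the intercept
   comes first, and show by induction on m that the m-th leading minor is almost
   surely nonzero.  Expanding along the last row, this minor is V + X W, where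
   X is the Gaussian corner entry, W is the previous minor, and V and W are
   functions of the other entries.  On W <> 0 it vanishes only if X = - V / W,
   which has probability zero since X is atomless and independent of V / W. *)
Require Import Defs.
From HB Require Import structures.
From mathcomp Require Import all_boot all_order all_algebra.
From mathcomp Require Import all_classical all_reals all_analysis.
From mathcomp Require Import perm measurable_realfun ring lra zify.
Set Implicit Arguments.
Unset Strict Implicit.
Unset Printing Implicit Defensive.
Import Order.TTheory GRing.Theory Num.Theory.
Import numFieldNormedType.Exports.
Local Open Scope classical_set_scope.
Local Open Scope ring_scope.

Section Count.
Variables (R : realType) (n k : nat).

Definition cover_count (i j : 'I_n) : R :=
  \sum_(A : {set 'I_n} | #|A| == k) (i \in A)%:R * (j \in A)%:R.

Lemma cover_count_perm (s : {perm 'I_n}) i j :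
  cover_count (s i) (s j) = cover_count i j.
Proof.
rewrite /cover_count (reindex_inj (imset_inj (@perm_inj _ s)))/=.
apply: eq_big => [A|A _]; first by rewrite card_imset//; exact: perm_inj.
by rewrite !mem_imset//; exact: perm_inj.
Qed.

Lemma cover_count_diag i j : cover_count i i = cover_count j j.
Proof. by rewrite -(cover_count_perm (tperm i j)) tpermL. Qed.

Lemma cover_count_offdiag i j j' : j != i -> j' != i ->
  cover_count i j = cover_count i j'.
Proof.
move=> ji j'i; rewrite -(cover_count_perm (tperm j j')) tpermL tpermD//.
Qed.

Lemma sum_indicator (A : {set 'I_n}) : \sum_i (i \in A)%:R = #|A|%:R :> R.
Proof.
rewrite -sum1_card natr_sum [RHS]big_mkcond/=; apply: eq_bigr => i _.
by case: (i \in A).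
Qed.

Lemma sum_cover_count i : \sum_j cover_count i j = k%:R * cover_count i i.
Proof.
rewrite exchange_big/= mulr_sumr; apply: eq_bigr => A /eqP Ak.
by rewrite -mulr_sumr sum_indicator Ak mulrC; case: (i \in A); rewrite ?mulr0 ?mulr1.
Qed.

Lemma sum_cover_count_diag : \sum_i cover_count i i = k%:R * 'C(n, k)%:R.
Proof.
rewrite exchange_big/= (eq_bigr (fun=> k%:R)) => [|A /eqP Ak].
  by rewrite sumr_const mulr_natr -[in RHS](card_ord n) -card_draws cardsE.
rewrite (eq_bigr (fun i => (i \in A)%:R)) ?sum_indicator ?Ak// => i _.
by case: (i \in A); rewrite ?mulr0 ?mulr1.
Qed.

Lemma cover_count_diagE i : n%:R * cover_count i i = k%:R * 'C(n, k)%:R.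
Proof.
rewrite -sum_cover_count_diag (eq_bigr (fun=> cover_count i i)).
  by rewrite sumr_const card_ord mulr_natl.
by move=> j _; exact: cover_count_diag.
Qed.

Lemma cover_count_offdiagE i j : j != i ->
  (n%:R - 1) * cover_count i j = (k%:R - 1) * cover_count i i.
Proof.
move=> ji; rewrite mulrBl mul1r [RHS]mulrBl mul1r -sum_cover_count (bigD1 i)//=.
rewrite addrAC subrr add0r (eq_bigr (fun=> cover_count i j)); last first.
  by move=> j' j'i; exact: cover_count_offdiag.
rewrite sumr_const cardC1 card_ord -[in LHS](@prednK n) ?(leq_trans _ (ltn_ord i))//.
by rewrite -natr1 mulrDl mul1r addrK mulr_natl.
Qed.

Lemma sum_quad_form_sets (M : 'M[R]_n) : (1 < n)%N ->
  \sum_i \sum_j M i j = 0 ->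
  \sum_(A : {set 'I_n} | #|A| == k) quad_form M (\col_i (i \in A)%:R) =
  'C(n, k)%:R * (k%:R * (n%:R - k%:R) / (n%:R * (n%:R - 1))) * \tr M.
Proof.
move=> n1 M0.
have n0 : (0 < n)%N by exact: ltnW.
have nR : n%:R != 0 :> R by rewrite pnatr_eq0 -lt0n.
have n1R : n%:R - 1 != 0 :> R by rewrite subr_eq0 pnatr_eq1 gtn_eqF.
pose a : R := k%:R * 'C(n, k)%:R / n%:R.
pose b : R := (k%:R - 1) * a / (n%:R - 1).
have aE i : cover_count i i = a.
  by rewrite /a -(cover_count_diagE i) mulrAC mulfV// mul1r.
have bE i j : j != i -> cover_count i j = b.
  by move=> ji; rewrite /b -(aE i) -(cover_count_offdiagE ji) mulrAC mulfV// mul1r.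
transitivity (\sum_i \sum_j M i j * cover_count i j).
  under [RHS]eq_bigr => i _ do under eq_bigr => j _ do rewrite mulr_sumr.
  under [RHS]eq_bigr => i _ do rewrite exchange_big/=.
  rewrite [RHS]exchange_big/=; apply: eq_bigr => A _.
  rewrite /quad_form !mxE exchange_big/=.
  under [LHS]eq_bigr => j _ do rewrite !mxE mulr_suml.
  apply: eq_bigr => j _; apply: eq_bigr => i _.
  by rewrite !mxE; ring.
have -> : \sum_i \sum_j M i j * cover_count i j =
    \sum_i \sum_j M i j * b + \sum_i M i i * (a - b).
  rewrite -big_split/=; apply: eq_bigr => i _.
  rewrite (bigD1 i)//= [in RHS](bigD1 i)//= aE mulrBr [RHS]addrAC.
  rewrite [M i i * b + _]addrC subrK; congr (_ + _).
  by apply: eq_bigr => j ji; rewrite bE.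
have -> : \sum_i \sum_j M i j * b = 0.
  transitivity ((\sum_i \sum_j M i j) * b); last by rewrite M0 mul0r.
  by rewrite mulr_suml; apply: eq_bigr => i _; rewrite mulr_suml.
rewrite add0r -mulr_suml mulrC -/(\tr M); congr (_ * _).
by rewrite /b /a; field; rewrite nR n1R.
Qed.

End Count.

Section Proj.
Variables (R : realType) (n p : nat) (Z : 'M[R]_(n, p)).
Hypothesis ZZ : Z^T *m Z \in unitmx.

Lemma tr_proj_orth : \tr (proj_orth Z) = n%:R - p%:R.
Proof.
rewrite /proj_orth linearB/= mxtrace1 mxtrace_mulC mulmxA mulmxV//.
by rewrite mxtrace1.
Qed.

Lemma proj_orth_mul : proj_orth Z *m Z = 0.
Proof. by rewrite /proj_orth mulmxBl mul1mx -!mulmxA mulVmx// mulmx1 subrr. Qed.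

End Proj.

Lemma sum_proj_orth (R : realType) (n p : nat) (Z : 'M[R]_(n, p)) (j : 'I_p) :
  Z^T *m Z \in unitmx -> (forall i, Z i j = 1) ->
  \sum_i \sum_l proj_orth Z i l = 0.
Proof.
move=> ZZ Z1; rewrite big1// => i _.
have /matrixP/(_ i j) := proj_orth_mul ZZ.
rewrite !mxE => {2}<-; apply: eq_bigr => l _.
by rewrite Z1 mulr1.
Qed.

Lemma gram_unitmx (R : realFieldType) (n p : nat) (Z : 'M[R]_(n, p)) :
  row_full Z -> Z^T *m Z \in unitmx.
Proof.
move=> /row_fullP[B BZ].
rewrite -row_free_unit -kermx_eq0; apply/eqP/row_matrixP => i.
rewrite row0; set u := row i _.
have /sub_kermxP uZZ : (u <= kermx (Z^T *m Z))%MS by exact: row_sub.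
suff uZ : u *m Z^T = 0.
  by rewrite -[u]mulmx1 -trmx1 -BZ trmx_mul mulmxA uZ mul0mx.
have /matrixP/(_ ord0 ord0) : (u *m Z^T) *m (u *m Z^T)^T = 0.
  by rewrite trmx_mul trmxK -mulmxA [Z^T *m _]mulmxA mulmxA uZZ mul0mx.
rewrite !mxE => uZ0; apply/rowP => j; rewrite [RHS]mxE; apply/eqP.
rewrite -sqrf_eq0; apply/eqP.
have : \sum_j ((u *m Z^T) ord0 j) ^+ 2 = 0.
  by rewrite -[RHS]uZ0; apply: eq_bigr => l _; rewrite [(_^T) _ _]mxE.
by move/psumr_eq0P => -> // l _; exact: sqr_ge0.
Qed.

Section Expectation.
Context d (T : measurableType d) (R : realType) (P : probability T R).
Variables (n k : nat) (x : 'I_n -> {RV P >-> R}).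
Hypothesis xk : random_assignment k x.

Let event (A : {set 'I_n}) := [set w | forall i, x i w = (i \in A)%:R].

Let measurable_event A : measurable (event A).
Proof.
have -> : event A = \bigcap_(i in [set: 'I_n]) (x i @^-1` [set (i \in A)%:R]).
  by apply/seteqP; split => w /= xA i; [move=> _|]; exact: xA.
apply: fin_bigcap_measurable => // i _.
Qed.

Lemma expectation_assignment (f : 'cV[R]_n -> R) :
  'E_P[fun w => f (assignment_vec x w)]%E =
  ((\sum_(A : {set 'I_n} | #|A| == k) f (\col_i (i \in A)%:R)) / 'C(n, k)%:R)%:E.
Proof.
have [x01 xP] := xk.
pose F (A : {set 'I_n}) : T -> R := f (\col_i (i \in A)%:R) \o* \1_(event A).
have LF A : \1_(event A) \in Lfun P 1.
  rewrite inE; apply/Lfun1_integrable.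
  exact: integrable_indic.
transitivity ('E_P[\sum_(X <- [seq F A | A <- index_enum {set 'I_n}]) X]%E).
  congr expectation; apply/funext => w; rewrite big_map fct_sumE.
  have xE i : x i w = (i \in [set i | x i w == 1]%SET)%:R.
    by rewrite inE; have [->|->] := x01 i w; rewrite ?eqxx// eq_sym oner_eq0.
  rewrite (bigD1 [set i | x i w == 1]%SET)//= big1 => [|A].
    rewrite /F/= indicE mem_set// mul1r addr0; congr f.
    by apply/colP => i; rewrite !mxE -xE.
  move=> nA; rewrite /F/= indicE memNset ?mul0r// => /= wA.
  move/eqP: nA; apply; apply/setP => i; rewrite inE wA.
  by case: (i \in A); rewrite ?eqxx// eq_sym oner_eq0.
rewrite expectation_sum => [|X /mapP[A _ ->]]; last first.
  by rewrite Lfun_scale.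
rewrite big_map/= mulr_suml -sumEFin [RHS]big_mkcond/=.
apply: eq_bigr => A _.
rewrite expectationZl// expectation_indic//= xP.
by case: ifP => _; rewrite ?mule0// EFinM.
Qed.

Lemma assignment_rateE p (Z : 'M[R]_(n, p)) (j : 'I_p) : (p < n)%N ->
  Z^T *m Z \in unitmx -> (forall i, Z i j = 1) -> (k <= n)%N ->
  assignment_rate x Z =
  (k%:R * (n%:R - k%:R) / (n%:R * (n%:R - 1)) * (n%:R - p%:R))%:E.
Proof.
move=> pn ZZ Zj kn; rewrite /assignment_rate (expectation_assignment (quad_form _)).
rewrite sum_quad_form_sets ?(sum_proj_orth ZZ Zj)//; last first.
  by rewrite (leq_trans _ pn)// ltnS (leq_trans _ (ltn_ord j)).
rewrite tr_proj_orth//; congr EFin.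
rewrite mulrC !mulrA mulVf ?mul1r// pnatr_eq0 -lt0n bin_gt0//.
Qed.

End Expectation.

Lemma measurable_inv (R : realType) : measurable_fun setT (@GRing.inv R).
Proof.
have o0 : open [set x : R | x != 0] by exact: open_neq.
have -> : [set: R] = [set x | x != 0] `|` [set 0].
  apply/seteqP; split => // x _ /=.
  by have [->|x0] := eqVneq x 0; [right|left].
apply/measurable_funU => //; first exact: open_measurable.
split; last exact: measurable_fun_set1.
apply: open_continuous_measurable_fun => //.
by apply/in_setP => x /= x0; exact: inv_continuous.
Qed.

Lemma normal_prob_set1 (R : realType) (m s y : R) : normal_prob m s [set y] = 0%E.
Proof.
have /null_content_dominatesP := @normal_prob_dominates R m s.
by apply => //; exact: lebesgue_measure_set1.
Qed.

Lemma measurable_det d (T : measurableType d) (R : realType) m (A : T -> 'M[R]_m) :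
  (forall i j, measurable_fun setT (fun w => A w i j)) ->
  measurable_fun setT (fun w => \det (A w)).
Proof.
move=> mA; apply: measurable_sum => s; apply: measurable_funM => //.
by apply: measurable_prod => i _; exact: mA.
Qed.

Section AlmostSureRank.
Context d (T : measurableType d) (R : realType) (P : probability T R).

(* The joint law of [X] and [U] is a product measure, so by Fubini the
   diagonal has mass [\int P (X = u) dP_U (u) = 0]. *)
Lemma atomless_eq_negligible (X U : {RV P >-> R}) :
  (forall y, P (X @^-1` [set y]) = 0%E) ->
  (forall A B : set R, measurable A -> measurable B ->
    P (X @^-1` A `&` U @^-1` B) = (P (X @^-1` A) * P (U @^-1` B))%E) ->
  P.-negligible [set w | X w = U w].
Proof.
move=> X0 XU.
pose UX : {RV P >-> (R * R)%type} :=
  mfun_Sub (mem_set (measurable_fun_pair (@measurable_funPT _ _ _ _ U)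
    (@measurable_funPT _ _ _ _ X))).
pose D : set (R * R) := (fun z => z.1 - z.2) @^-1` [set 0].
have mD : measurable D.
  have mB : measurable_fun setT (fun z : R * R => z.1 - z.2).
    exact: measurable_funB.
  by rewrite /D -[X in measurable X]setTI; exact: mB.
have -> : [set w | X w = U w] = UX @^-1` D.
  apply/seteqP; split => w /=; rewrite /D/=; first by move=> ->; rewrite subrr.
  by move=> /subr0_eq ->.
apply/negligibleP; first by rewrite -[X in measurable X]setTI; exact: measurable_funP.
rewrite -[LHS]/(distribution P UX D).
rewrite -(@product_measure_unique _ _ _ _ R (distribution P U) (distribution P X))//.
  rewrite /product_measure1 integral0_eq// => u _ /=.
  suff -> : xsection D u = [set u] by exact: X0.
  apply/seteqP; split => y; rewrite /xsection/= inE/D/=.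
    by move/subr0_eq.
  by move=> ->; rewrite subrr.
move=> A B mA mB; rewrite -[LHS]/(P (U @^-1` A `&` X @^-1` B)).
by rewrite setIC XU// muleC.
Qed.

Section OtherEvents.
Variables (I : finType) (D : {set I}) (X : I -> {RV P >-> R}).
Hypothesis indep : mutually_independent D X.
Variable i0 : I.
Hypothesis i0D : i0 \in D.

Definition other_events : set (set T) :=
  \bigcup_(i in [set` (D :\ i0)%SET]) preimage_set_system setT (X i) measurable.

Let cylinders : set (set T) := [set A | exists2 B : I -> set R,
  (forall i, measurable (B i)) &
  A = \bigcap_(i in [set` (D :\ i0)%SET]) X i @^-1` B i].

Let measurable_cylinders : cylinders `<=` measurable.
Proof.
move=> _ [B mB ->]; apply: fin_bigcap_measurable => // i _.
by rewrite -[X in measurable X]setTI; exact: measurable_funP.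
Qed.

Let cylinders_setI : setI_closed cylinders.
Proof.
move=> _ _ [B mB ->] [C mC ->]; exists (fun i => B i `&` C i).
  by move=> i; exact: measurableI.
by rewrite -bigcapI.
Qed.

Let other_events_cylinders : other_events `<=` cylinders.
Proof.
move=> _ [i /= iD [B mB <-]]; exists (fun j => if j == i then B else setT).
  by move=> j; case: ifP.
rewrite setTI; apply/seteqP; split => w /= Bw.
  by move=> j /= _; case: eqP => // ->.
by have := Bw _ iD; rewrite /= eqxx.
Qed.

Lemma mutually_independent_others A B : <<s other_events >> A -> measurable B ->
  P (X i0 @^-1` B `&` A) = (P (X i0 @^-1` B) * P A)%E.
Proof.
move=> sA mB; set E := X i0 @^-1` B.
have mE : measurable E.
  by rewrite /E -[X in measurable X]setTI; exact: measurable_funP.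
have {}sA : <<s cylinders >> A.
  by move: A sA; exact: sub_smallest2r.
have PE : fine (P E) >= 0 by exact: fine_ge0.
rewrite setIC -[LHS]/(mrestr P mE A).
have -> : (P E * P A)%E = mscale (NngNum PE) P A.
  by rewrite -[in LHS](fineK (fin_num_measure P E mE)).
apply: (@g_sigma_algebra_measure_unique _ _ _ cylinders _ (fun=> setT)) => //.
- move=> _; exists (fun=> setT) => //.
  by apply/seteqP; split.
- by rewrite bigcup_const.
- move=> _ [C mC ->]; rewrite -[RHS]/((fine (P E))%:E * P _)%E (fineK (fin_num_measure P E mE)).
  pose F i := if i == i0 then B else C i.
  have mF i : measurable (F i) by rewrite /F; case: ifP.
  have FE : \bigcap_(i in [set` D]) (X i @^-1` F i) =
      \bigcap_(i in [set` (D :\ i0)%SET]) (X i @^-1` C i) `&` E.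
    apply/seteqP; split => w /=.
      move=> Fw; split; last by have := Fw _ i0D; rewrite /F/= eqxx.
      move=> i; rewrite /= !inE => /andP[ii0 iD].
      by have := Fw _ iD; rewrite /F/= (negbTE ii0).
    move=> [Cw Ew] i /= iD; rewrite /F; case: eqP => [->//|/eqP ii0].
    by apply: Cw; rewrite /= !inE ii0.
  transitivity (P (\bigcap_(i in [set` D]) (X i @^-1` F i))); first by rewrite FE.
  rewrite indep// (big_setD1 i0)//= {1}/F eqxx; congr (_ * _)%E.
  rewrite [RHS]indep ?subD1set//.
  by apply: eq_bigr => i; rewrite !inE /F => /andP[/negbTE ->].
- by move=> _; rewrite /mrestr (le_lt_trans (probability_le1 _ _))// ?ltry//; apply: measurableI.
Qed.

Lemma other_events_measurable (A : set T) : <<s other_events >> A -> measurable A.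
Proof.
apply: smallest_sub; first exact: sigma_algebra_measurable.
by move=> B /other_events_cylinders; exact: measurable_cylinders.
Qed.

Lemma measurable_other i : i \in D -> i != i0 ->
  measurable_fun [set: g_sigma_algebraType other_events] (X i).
Proof.
move=> iD ii0 _ B mB; apply: sub_sigma_algebra; exists i; last by exists B.
by rewrite /= !inE ii0.
Qed.

Lemma affine_negligible (V W : g_sigma_algebraType other_events -> R) :
  measurable_fun setT V -> measurable_fun setT W ->
  (forall y, P (X i0 @^-1` [set y]) = 0%E) ->
  P.-negligible [set w | W w = 0] ->
  P.-negligible [set w | V w + X i0 w * W w = 0].
Proof.
move=> mV mW X0 W0.
pose U : g_sigma_algebraType other_events -> R := fun w => - V w * (W w)^-1.
have mU : measurable_fun setT U.
  apply: measurable_funM; first exact: measurableT_comp.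
  exact: (measurableT_comp (@measurable_inv R)).
have mUT : measurable_fun [set: T] (U : T -> R).
  by move=> _ B mB; apply: other_events_measurable; have := mU measurableT B mB.
pose U' : {RV P >-> R} := mfun_Sub (mem_set mUT).
have XU : P.-negligible [set w | X i0 w = U' w].
  apply: atomless_eq_negligible => // A B mA mB.
  rewrite (mutually_independent_others _ mA)//.
  by have := mU measurableT B mB; rewrite setTI.
apply: negligibleS (negligibleU W0 XU) => w /= VXW.
have [->|W0w] := eqVneq (W w) 0; [by left|right].
apply: (mulIf W0w); rewrite /= /U mulfVK//.
by apply/eqP; rewrite -addr_eq0 addrC VXW.
Qed.

End OtherEvents.

Section FullRank.
Variables (n p : nat) (Z : 'I_n * 'I_p -> {RV P >-> R}).
Hypothesis gZ : gaussian_covariates Z.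
Hypothesis pn : (p < n)%N.

Let leading m (mp : (m <= p)%N) (w : T) : 'M[R]_m :=
  \matrix_(i, j) Z (widen_ord (ltnW pn) (widen_ord mp i),
                    rev_ord (widen_ord mp j)) w.

Lemma measurable_covariate ij0 ij : ij != ij0 ->
  measurable_fun [set: g_sigma_algebraType
    (other_events (covariate_entries n p) Z ij0)] (Z ij).
Proof.
move=> ne; have [Dij|] := boolP (ij \in covariate_entries n p).
  exact: measurable_other.
rewrite inE -leqNgt => pj; case: gZ => Z1 _ _.
have -> : (Z ij : T -> R) = cst 1; last exact: measurable_cst.
apply/funext => w; rewrite [ij]surjective_pairing Z1//.
by apply/eqP; rewrite eqn_leq pj ltn_ord.
Qed.

Lemma leading_negligible m (mp : (m <= p)%N) :
  P.-negligible [set w | \det (leading mp w) = 0].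
Proof.
have [Z1 ZN Zi] := gZ.
elim: m mp => [|m IH] mp.
  by apply: negligibleS (negligible_set0 P) => w/=; rewrite det_mx00 => /eqP; rewrite oner_eq0.
pose ij0 := (widen_ord (ltnW pn) (widen_ord mp ord_max), rev_ord (widen_ord mp ord_max)).
have [m0|m0] := posnP m.
  subst m; apply: negligibleS (negligible_set0 P) => w/=.
  rewrite det_mx11 mxE Z1 => [/eqP|/=]; first by rewrite oner_eq0.
  by rewrite subn1 prednK.
pose V w := \sum_(j < m.+1 | j != ord_max)
  leading mp w ord_max j * cofactor (leading mp w) ord_max j.
pose W w := cofactor (leading mp w) ord_max ord_max.
have ij0D : ij0 \in covariate_entries n p by rewrite inE/=; lia.
have mcof j : measurable_fun [set: g_sigma_algebraType
    (other_events (covariate_entries n p) Z ij0)]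
    (fun w => cofactor (leading mp w) ord_max j).
  apply: measurable_funM => //; apply: measurable_det => i l.
  under eq_fun do rewrite !mxE.
  apply: measurable_covariate; rewrite xpair_eqE negb_and; apply/orP; left.
  by apply/eqP => /(congr1 val)/= /eqP; rewrite eq_sym (negbTE (neq_bump _ _)).
have := @affine_negligible _ _ _ Zi ij0 ij0D V W.
have -> : [set w | V w + Z ij0 w * W w = 0] = [set w | \det (leading mp w) = 0].
  congr mkset; apply/funext => w.
  by rewrite (expand_det_row _ ord_max) (bigD1 ord_max)//= addrC mxE.
apply.
- rewrite /V; under eq_fun do rewrite big_mkcond/=.
  apply: measurable_sum => j; case: (eqVneq j ord_max) => [_|jm] //=.
  apply: measurable_funM; last exact: mcof.
  under eq_fun do rewrite !mxE.
  apply: measurable_covariate; rewrite xpair_eqE negb_and; apply/orP; right.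
  apply: contra jm => /eqP/(congr1 val)/=; have := ltn_ord j => jm e.
  by apply/eqP/val_inj => /=; lia.
- exact: mcof.
- move=> y; rewrite -[LHS]/(distribution P (Z ij0) [set y]) ZN//.
  exact: normal_prob_set1.
- have mp' : (m <= p)%N by exact: ltnW.
  apply: negligibleS (IH mp') => w/=; rewrite /W /cofactor => /eqP.
  rewrite mulf_eq0 signr_eq0/= => /eqP; congr (\det _ = 0).
  apply/matrixP => i j; rewrite !mxE; congr (Z (_, _) w).
    by apply/val_inj => /=; rewrite /bump leqNgt ltn_ord.
  by apply/val_inj => /=; rewrite /bump leqNgt ltn_ord.
Qed.

Lemma covariate_full_rank :
  {ae P, forall w, row_full (covariate_mx Z w)}.
Proof.
apply: negligibleS (leading_negligible (leqnn p)) => w /=.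
apply: contra_notP => /eqP detN.
rewrite /row_full -mxrank_tr; apply/inj_row_free => u uZ.
have uL : (\row_j u ord0 (rev_ord j)) *m (leading (leqnn p) w)^T = 0.
  apply/rowP => i; have /rowP/(_ (widen_ord (ltnW pn) i)) := uZ.
  rewrite !mxE => {2}<-; rewrite [RHS](reindex_inj rev_ord_inj)/=.
  apply: eq_bigr => j _; rewrite !mxE; congr (_ * Z (_, _) w).
    by apply/val_inj.
  by congr rev_ord; apply/val_inj.
have uL' : (leading (leqnn p) w)^T \in unitmx by rewrite unitmx_tr unitmxE unitfE.
have /rowP u0 : \row_j u ord0 (rev_ord j) = 0 by rewrite -[LHS](mulmxK uL') uL mul0mx.
by apply/rowP => j; have := u0 (rev_ord j); rewrite !mxE rev_ordK.
Qed.

End FullRank.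
End AlmostSureRank.

Lemma rate_bounds (R : realFieldType) (n : nat) (a b : R) : (1 < n)%N ->
  0 <= a -> 0 <= b ->
  b * (a / n%:R ^+ 2) <= a / (n%:R * (n%:R - 1)) * b <= 2 * (b * (a / n%:R ^+ 2)).
Proof.
move=> n1 a0 b0; have n2 : 2 <= n%:R :> R by rewrite ler_nat.
have ab0 : 0 <= a * b by exact: mulr_ge0.
have lo : (n%:R ^+ 2)^-1 <= (n%:R * (n%:R - 1))^-1 :> R.
  by rewrite lef_pV2 ?posrE; nra.
have hi : (n%:R * (n%:R - 1))^-1 <= 2 * (n%:R ^+ 2)^-1 :> R.
  by rewrite -[X in X * _^-1]invrK -invfM lef_pV2 ?posrE; nra.
have -> : b * (a / n%:R ^+ 2) = a * b * (n%:R ^+ 2)^-1 by ring.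
by rewrite [2 * _]mulrCA [a / _ * b]mulrAC !ler_wpM2l.
Qed.

Lemma ae_assignment_rate d (T : measurableType d) (R : realType)
    (P : probability T R) (n p k : nat)
    (Z : 'I_n * 'I_p -> {RV P >-> R}) (x : 'I_n -> {RV P >-> R}) :
  (1 <= p < n)%N -> (0 < k < n)%N ->
  gaussian_covariates Z -> random_assignment k x ->
  {ae P, forall w, assignment_rate x (covariate_mx Z w) =
    (k%:R * (n%:R - k%:R) / (n%:R * (n%:R - 1)) * (n%:R - p%:R))%:E}.
Proof.
move=> /andP[p0 pn] /andP[_ kn] gZ rx.
apply: filterS (covariate_full_rank gZ pn) => w fZ.
have jp : (p.-1 < p)%N by rewrite prednK.
apply: (@assignment_rateE _ _ _ _ _ _ _ rx _ _ (Ordinal jp)) => //.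
- exact: gram_unitmx.
- by move=> i; case: gZ => Z1 _ _; rewrite mxE Z1//= prednK.
- exact: ltnW.
Qed.

Theorem theorem1 (R : realType) :
  (exists c C : R, [/\ 0 < c, c <= C &
    forall (n p k : nat) (d : measure_display) (T : measurableType d)
      (P : probability T R)
      (Z : 'I_n * 'I_p -> {RV P >-> R}) (x : 'I_n -> {RV P >-> R}),
      (1 <= p < n)%N -> (0 < k < n)%N ->
      gaussian_covariates Z -> random_assignment k x ->
      independent_families x Z ->
      {ae P, forall w,
        ((c * ((n%:R - p%:R) * (k%:R * (n%:R - k%:R) / n%:R ^+ 2)))%:E
           <= assignment_rate x (covariate_mx Z w)
           <= (C * ((n%:R - p%:R) * (k%:R * (n%:R - k%:R) / n%:R ^+ 2)))%:E)%E}])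
  /\
  (forall rho : R, 0 < rho < 1 ->
    exists c C : R, [/\ 0 < c, c <= C &
      forall (n p k : nat) (d : measure_display) (T : measurableType d)
        (P : probability T R)
        (Z : 'I_n * 'I_p -> {RV P >-> R}) (x : 'I_n -> {RV P >-> R}),
        (1 <= p < n)%N -> (0 < k < n)%N -> k%:R / n%:R = rho ->
        gaussian_covariates Z -> random_assignment k x ->
        independent_families x Z ->
        {ae P, forall w,
          ((c * (n%:R - p%:R))%:E
             <= assignment_rate x (covariate_mx Z w)
             <= (C * (n%:R - p%:R))%:E)%E}]).
Proof.
split.
  exists 1, 2; split => //; first by rewrite ler1n.
  move=> n p k d T P Z x pn kn gZ rx _.
  apply: filterS (ae_assignment_rate pn kn gZ rx) => w ->.
  case/andP: pn => p0 pn; case/andP: kn => k0 kn.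
  rewrite !lee_fin mul1r; apply: rate_bounds.
  - exact: leq_ltn_trans pn.
  - by rewrite mulr_ge0// subr_ge0 ler_nat ltnW.
  - by rewrite subr_ge0 ler_nat ltnW.
move=> rho /andP[rho0 rho1].
have r0 : 0 < rho * (1 - rho) by rewrite mulr_gt0// subr_gt0.
exists (rho * (1 - rho)), (2 * (rho * (1 - rho))); split => //; first by lra.
move=> n p k d T P Z x pn kn knr gZ rx _.
apply: filterS (ae_assignment_rate pn kn gZ rx) => w ->.
case/andP: pn => p0 pn; case/andP: kn => k0 kn.
have n0 : n%:R != 0 :> R by rewrite pnatr_eq0 -lt0n (ltn_trans k0).
have -> : rho * (1 - rho) = k%:R * (n%:R - k%:R) / n%:R ^+ 2.
  by rewrite -knr; field.
rewrite !lee_fin -[2 * _ * _]mulrA ![_ / _ ^+ 2 * _]mulrC; apply: rate_bounds.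
- exact: leq_ltn_trans pn.
- by rewrite mulr_ge0// subr_ge0 ler_nat ltnW.
- by rewrite subr_ge0 ler_nat ltnW.
Qed.
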